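(* (2D generalized LF splitting.) Let $Q\ge1$, let $\Delta x,\Delta y>0$, and let $\omega_1,\dots,\omega_Q>0$ with $\sum_{i=1}^Q\omega_i=1$. If $\bar{\mathbf U}^i,\tilde{\mathbf U}^i,\hat{\mathbf U}^i,\check{\mathbf U}^i\in\mathcal G$ for $i=1,\dots,Q$ satisfy the 2D discrete divergence-free condition $$\frac{\sum_{i=1}^Q\omega_i(\bar B_1^i-\tilde B_1^i)}{\Delta x}+\frac{\sum_{i=1}^Q\omega_i(\hat B_2^i-\check B_2^i)}{\Delta y}=0,$$ then for any $\alpha_1^{LF}$ and $\alpha_2^{LF}$ satisfying $$\alpha_1^{LF}>\max_{1\le i\le Q}\alpha_1(\bar{\mathbf U}^i,\tilde{\mathbf U}^i),\qquad \alpha_2^{LF}>\max_{1\le i\le Q}\alpha_2(\hat{\mathbf U}^i,\check{\mathbf U}^i),$$ it holds that $$\overline{\mathbf U}:=\frac{1}{2\big(\frac{\alpha_1^{LF}}{\Delta x}+\frac{\alpha_2^{LF}}{\Delta y}\big)}\sum_{i=1}^Q\omega_i\Big[\frac{\alpha_1^{LF}}{\Delta x}\Big(\bar{\mathbf U}^i-\frac{\mathbf F_1(\bar{\mathbf U}^i)}{\alpha_1^{LF}}+\tilde{\mathbf U}^i+\frac{\mathbf F_1(\tilde{\mathbf U}^i)}{\alpha_1^{LF}}\Big)+\frac{\alpha_2^{LF}}{\Delta y}\Big(\hat{\mathbf U}^i-\frac{\mathbf F_2(\hat{\mathbf U}^i)}{\alpha_2^{LF}}+\check{\mathbf U}^i+\frac{\mathbf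 F_2(\check{\mathbf U}^i)}{\alpha_2^{LF}}\Big)\Big]\in\mathcal G.$$
   Context: A state is $\mathbf U=(\rho,\mathbf m,\mathbf B,E)^\top\in\mathbb R^8$ with $\rho,E\in\mathbb R$, $\mathbf m,\mathbf B\in\mathbb R^3$; accents and superscripts on components (e.g. $\bar B_1^i$) refer to the state carrying them. For $\rho>0$ put $\mathbf v=\mathbf m/\rho$, $\mathcal E(\mathbf U)=E-\frac12\big(\frac{|\mathbf m|^2}{\rho}+|\mathbf B|^2\big)$, $e=\mathcal E(\mathbf U)/\rho$, $p=p(\rho,e)$, $p_{tot}=p+\frac{|\mathbf B|^2}{2}$. The equation of state $p(\rho,e)$ is any function such that, whenever $\rho>0$, one has $e>0\Leftrightarrow p(\rho,e)>0$. Admissible states: $\mathcal G=\{\mathbf U:\rho>0,\ \mathcal E(\mathbf U)>0\}$. Flux: $$\mathbf F_i(\mathbf U)=\big(\rho v_i,\ \rho v_i\mathbf v-B_i\mathbf B+p_{tot}\mathbf e_i,\ v_i\mathbf B-B_i\mathbf v,\ v_i(E+p_{tot})-B_i(\mathbf v\cdot\mathbf B)\big)^\top,$$ with $\mathbf e_i$ the $i$-th standard unit vector of $\mathbb R^3$. For $\mathbf U,\tilde{\mathbf U}\in\mathcal G$, $\alpha_i(\mathbf U,\tilde{\mathbf U})=\min_{\sigma\in\mathbb R}\alpha_i(\mathbf U,\tilde{\mathbf U};\sigma)$ with $$\alpha_i(\mathbf U,\tilde{\mathbf U};\sigma)=\max\big\{|v_i|+\mathscr C_i,\ |\tilde v_i|+\tilde{\mathscr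 C}_i,\ |\sigma v_i+(1-\sigma)\tilde v_i|+\max\{\mathscr C_i,\tilde{\mathscr C}_i\}\big\}+\frac{|\tilde{\mathbf B}-\mathbf B|}{\sqrt2}\sqrt{\frac{\sigma^2}{\rho}+\frac{(1-\sigma)^2}{\tilde\rho}},$$ $$\mathscr C_i=\frac1{\sqrt2}\Big[\mathscr C_s^2+\frac{|\mathbf B|^2}{\rho}+\sqrt{\Big(\mathscr C_s^2+\frac{|\mathbf B|^2}{\rho}\Big)^2-4\frac{\mathscr C_s^2B_i^2}{\rho}}\Big]^{1/2},\qquad \mathscr C_s=\frac{p}{\rho\sqrt{2e}},$$ and $\tilde{\mathscr C}_i$ the same quantity for $\tilde{\mathbf U}$. *)

(* Defs.v *)
From mathcomp Require Import all_boot all_order all_algebra.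
From mathcomp Require Import all_classical all_reals all_analysis.
From mathcomp Require Import ring.
Import Order.TTheory GRing.Theory Num.Theory.
Import numFieldNormedType.Exports.
Set Implicit Arguments.
Unset Strict Implicit.
Unset Printing Implicit Defensive.
Local Open Scope classical_set_scope.
Local Open Scope ring_scope.

(* A column vector of R^8 (1 + (3 + (3 + 1)) computes to 8), split into the
   blocks rho, m, B, E. *)
Definition state (R : realType) := 'cV[R]_(1 + (3 + (3 + 1))).

Definition mk_state (R : realType) (r : R) (m B : 'cV[R]_3) (E : R) : state R :=
  col_mx r%:M (col_mx m (col_mx B E%:M)).

Definition rho (R : realType) (U : state R) : R := usubmx U 0 0.
Definition mom (R : realType) (U : state R) : 'cV[R]_3 := usubmx (dsubmx U).
Definition mag (R : realType) (U : state R) : 'cV[R]_3 :=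
  usubmx (dsubmx (dsubmx U)).
Definition energy (R : realType) (U : state R) : R :=
  dsubmx (dsubmx (dsubmx U)) 0 0.

Definition dot (R : realType) (x y : 'cV[R]_3) : R :=
  \sum_(k < 3) x k 0 * y k 0.

(* The Euclidean norm; `|x| on matrices is the sup norm. *)
Definition enorm (R : realType) (x : 'cV[R]_3) : R := Num.sqrt (dot x x).

(* The first and second coordinate directions of R^3. *)
Definition dir1 : 'I_3 := @Ordinal 3 0 isT.
Definition dir2 : 'I_3 := @Ordinal 3 1 isT.

Definition vel (R : realType) (U : state R) : 'cV[R]_3 := (rho U)^-1 *: mom U.

Definition internal_energy (R : realType) (U : state R) : R :=
  energy U - 2^-1 * (enorm (mom U) ^+ 2 / rho U + enorm (mag U) ^+ 2).

Definition spec_energy (R : realType) (U : state R) : R :=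
  internal_energy U / rho U.

Definition is_eos (R : realType) (p : R -> R -> R) : Prop :=
  forall r e : R, 0 < r -> (0 < e <-> 0 < p r e).

Definition pressure (R : realType) (p : R -> R -> R) (U : state R) : R :=
  p (rho U) (spec_energy U).

Definition ptot (R : realType) (p : R -> R -> R) (U : state R) : R :=
  pressure p U + enorm (mag U) ^+ 2 / 2.

Definition admissible (R : realType) : set (state R) :=
  [set U | 0 < rho U /\ 0 < internal_energy U].

Definition flux (R : realType) (p : R -> R -> R) (i : 'I_3) (U : state R) :
    state R :=
  let v := vel U in let B := mag U in
  mk_state
    (rho U * v i 0)
    ((rho U * v i 0) *: v - B i 0 *: B + ptot p U *: delta_mx i 0)
    (v i 0 *: B - B i 0 *: v)
    (v i 0 * (energy U + ptot p U) - B i 0 * dot v B).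

Definition Cs (R : realType) (p : R -> R -> R) (U : state R) : R :=
  pressure p U / (rho U * Num.sqrt (2 * spec_energy U)).

Definition Cdir (R : realType) (p : R -> R -> R) (i : 'I_3) (U : state R) : R :=
  let a := Cs p U ^+ 2 + enorm (mag U) ^+ 2 / rho U in
  (Num.sqrt 2)^-1 *
  Num.sqrt (a + Num.sqrt (a ^+ 2 - 4 * (Cs p U ^+ 2 * mag U i 0 ^+ 2 / rho U))).

Definition alpha_sigma (R : realType) (p : R -> R -> R) (i : 'I_3)
    (U U' : state R) (s : R) : R :=
  Num.max
    (Num.max (`|vel U i 0| + Cdir p i U) (`|vel U' i 0| + Cdir p i U'))
    (`|s * vel U i 0 + (1 - s) * vel U' i 0| + Num.max (Cdir p i U) (Cdir p i U'))
  + enorm (mag U' - mag U) / Num.sqrt 2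
    * Num.sqrt (s ^+ 2 / rho U + (1 - s) ^+ 2 / rho U').

(* The minimum over sigma, written as an infimum to get a total function; on
   admissible states it is attained, see alpha_is_min. *)
Definition alpha (R : realType) (p : R -> R -> R) (i : 'I_3)
    (U U' : state R) : R :=
  inf [set alpha_sigma p i U U' s | s in [set: R]].

(* The maximum of a nonempty finite family; the base value is its first member. *)
Definition max_over (R : realType) (Q : nat) (Q_gt0 : (0 < Q)%N)
    (f : 'I_Q -> R) : R :=
  \big[Num.max/f (Ordinal Q_gt0)]_(k < Q) f k.

Lemma Cdir_ge0 (R : realType) (p : R -> R -> R) (i : 'I_3) (U : state R) :
  0 <= Cdir p i U.
Proof. by rewrite mulr_ge0 ?invr_ge0 ?sqrtr_ge0. Qed.

Lemma continuous_alpha_sigma (R : realType) (p : R -> R -> R) (i : 'I_3)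
    (U U' : state R) : continuous (alpha_sigma p i U U' : R -> R).
Proof.
move=> s.
have cB : 1 - x @[x --> s] --> 1 - s by apply: cvgB; [exact: cvg_cst|exact: cvg_id].
apply: cvgD.
  apply: (@continuous_max R R
    (fun=> Num.max (`|vel U i 0| + Cdir p i U) (`|vel U' i 0| + Cdir p i U'))
    (fun s => `|s * vel U i 0 + (1 - s) * vel U' i 0|
      + Num.max (Cdir p i U) (Cdir p i U')) s); first exact: cvg_cst.
  apply: cvgD; last exact: cvg_cst.
  apply: cvg_norm; apply: cvgD; apply: cvgM => //; exact: cvg_cst.
apply: cvgM; [exact: cvg_cst|].
apply: (cvg_comp (fun x : R => x ^+ 2 / rho U + (1 - x) ^+ 2 / rho U') Num.sqrt);
  last exact: sqrt_continuous.
by apply: cvgD; apply: cvgM; [exact: cvgM|exact: cvg_cst|exact: cvgM|exact: cvg_cst].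
Qed.

Lemma min_attained (R : realType) (f : R -> R) (a b : R) :
  continuous f -> 0 < a -> (forall s, a * `|s| - b <= f s) ->
  exists s, forall t, f s <= f t.
Proof.
move=> cf a0 lef.
pose M := `|(f 0 + b) / a|.
have MM : - M <= M by rewrite (@le_trans _ _ 0) ?oppr_le0 ?normr_ge0.
have [|c _ cmin] := @EVT_min R f (- M) M MM.
  exact: continuous_subspaceT.
exists c => t; have [tM|Mt] := leP `|t| M.
  by apply: cmin; rewrite in_itv /= -ler_norml.
apply: (@le_trans _ _ (f 0)).
  by apply: cmin; rewrite in_itv /= oppr_le0 normr_ge0.
apply: le_trans (lef t).
have : (f 0 + b) / a <= `|t| by rewrite (le_trans (ler_norm _)) // ltW.
by rewrite ler_pdivrMr // lerBrDr mulrC.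
Qed.

Lemma alpha_is_min (R : realType) (p : R -> R -> R) (i : 'I_3)
    (U U' : state R) :
  admissible U -> admissible U' ->
  exists2 s, alpha p i U U' = alpha_sigma p i U U' s
    & forall t, alpha_sigma p i U U' s <= alpha_sigma p i U U' t.
Proof.
move=> [r0 _] [r0' _].
suff [s smin] : exists s, forall t,
    alpha_sigma p i U U' s <= alpha_sigma p i U U' t.
  exists s => //; apply/eqP; rewrite eq_le; apply/andP; split.
    apply: ge_inf; last by exists s.
    by exists (alpha_sigma p i U U' s) => _ [t _ <-].
  apply: lb_le_inf; first by exists (alpha_sigma p i U U' s), s.
  by move=> _ [t _ <-].
have cf := @continuous_alpha_sigma R p i U U'.
set v := vel U i 0 in cf *; set w := vel U' i 0 in cf *.
have D0 : 0 <= enorm (mag U' - mag U) / Num.sqrt 2.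
  by rewrite divr_ge0 ?sqrtr_ge0.
have C0 := Cdir_ge0 p i U.
have [Dz|Dnz] := eqVneq (enorm (mag U' - mag U)) 0.
  have [vw|vw] := eqVneq v w.
    exists 0 => t; rewrite /alpha_sigma -/v -/w -vw Dz !mul0r.
    by have -> : t * v + (1 - t) * v = 0 + (1 - 0) * v by ring.
  apply: (@min_attained _ _ `|v - w| `|w|) => //.
    by rewrite normr_gt0 subr_eq0.
  move=> s; rewrite /alpha_sigma -/v -/w Dz !mul0r addr0 le_max.
  apply/orP; right; apply: (@le_trans _ _ `|s * v + (1 - s) * w|).
    have -> : s * v + (1 - s) * w = (v - w) * s - (- w) by ring.
    by rewrite -normrM (le_trans _ (lerB_dist _ _)) // normrN.
  by rewrite lerDl le_max C0.
apply: (@min_attained _ _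
  (enorm (mag U' - mag U) / Num.sqrt 2 * Num.sqrt (rho U)^-1) 0) => //.
  have Dp : 0 < enorm (mag U' - mag U) by rewrite lt_def Dnz sqrtr_ge0.
  apply: mulr_gt0; last by rewrite sqrtr_gt0 invr_gt0.
  by apply: divr_gt0 => //; rewrite sqrtr_gt0 ltr0n.
move=> s; rewrite subr0 /alpha_sigma.
rewrite -[leLHS]add0r lerD //.
  by rewrite !le_max addr_ge0 ?normr_ge0.
rewrite -mulrA ler_wpM2l // -sqrtr_sqr mulrC -sqrtrM ?sqr_ge0 //.
by rewrite ler_wsqrtr // lerDl divr_ge0 ?sqr_ge0 ?ltW.
Qed.

(* Main.v *)
Require Import Defs.
From mathcomp Require Import all_boot all_order all_algebra.
From mathcomp Require Import all_classical all_reals all_analysis.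
From mathcomp Require Import ring lra.
Import Order.TTheory GRing.Theory Num.Theory.
Local Open Scope ring_scope.
Set Implicit Arguments.
Unset Strict Implicit.

(** The obstacle is that the internal energy is not linear in the state, so it
    does not commute with averaging.  For fixed reference vectors v and B the
    functional probe v B U = E + rho |v|^2/2 - v . m - B . B_U is linear in U,
    and completing the squares gives (lemma probeE)

      probe v B U + |B|^2/2
        = rho |v_U - v|^2/2 + internal_energy U + |B_U - B|^2/2.

    The squares vanish when v and B are the velocity and the magnetic field of
    U itself.  Hence it is enough to prove probe v B W + |B|^2/2 > 0 for the
    average W, with v and B taken from W, and by linearity this is a statement
    about the individual pairs of states that enter W.

    For one pair U, U' in direction i, write w = v_U - v and b = B_U - B.  By
    probe_flux, the flux contributes

      v_U_i (rho |w|^2/2 + internal_energy U) + v_i |b|^2/2 + X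
        + B_U_i (v . B) - v_i |B|^2/2,

    where X is a quadratic form in w, b and the square root of the internal
    energy.  Three facts bound the difference of the two fluxes by alpha_sigma
    times the energies of the pair:
    - the fast magnetosonic speed Cdir is the largest eigenvalue of the form X
      relative to the energy form, which gives wave_bound;
    - v_i |b|^2/2 is multiplied by the unbounded v_i, but only the difference
      v_i (|b|^2 - |b'|^2)/2 occurs; writing v_i as s v_U_i + (1 - s) v_U'_i
      minus s w_i + (1 - s) w'_i, the first part is a bounded speed and the
      second one is paid for by the term of alpha_sigma that is proportional
      to |B_U' - B_U| (coupling_bound);
    - the terms v_i |B|^2/2 cancel within the pair.
    What is left over is (B_U_i - B_U'_i) (v . B), which has no sign.  It is
    proportional to v . B, and this factor is the same for all pairs, so the
    discrete divergence-free condition removes it from the sum over all pairs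
    in both directions (average_gt0).

    The density is itself linear, and is treated by the same averaging lemma
    with no constant term and no divergence term. *)

(** * The Euclidean product on R^3 *)

Section Dot.
Variable R : realType.
Implicit Types (x y z : 'cV[R]_3) (i : 'I_3).

Lemma dotE x y : dot x y = x 0 0 * y 0 0 + x 1 0 * y 1 0 + x 2 0 * y 2 0.
Proof.
rewrite /dot !big_ord_recl big_ord0 addr0 addrA.
by congr (_ + _ * _ + _ * _); congr (fun_of_matrix _ _ _); apply/val_inj.
Qed.

Lemma dotC x y : dot x y = dot y x.
Proof. by rewrite !dotE; ring. Qed.

Lemma dotDl x y z : dot (x + y) z = dot x z + dot y z.
Proof. by rewrite !dotE !mxE; ring. Qed.

Lemma dotZl a x y : dot (a *: x) y = a * dot x y.
Proof. by rewrite !dotE !mxE; ring. Qed.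

Lemma dotNl x y : dot (- x) y = - dot x y.
Proof. by rewrite -scaleN1r dotZl mulN1r. Qed.

Lemma dotDr x y z : dot x (y + z) = dot x y + dot x z.
Proof. by rewrite !(dotC x) dotDl. Qed.

Lemma dotZr a x y : dot x (a *: y) = a * dot x y.
Proof. by rewrite !(dotC x) dotZl. Qed.

Lemma dotNr x y : dot x (- y) = - dot x y.
Proof. by rewrite !(dotC x) dotNl. Qed.

Definition dot_lin := (dotDl, dotDr, dotZl, dotZr, dotNl, dotNr).

Lemma dot_delta x i : dot x (delta_mx i 0) = x i 0.
Proof.
rewrite /dot (bigD1 i) //= big1 ?addr0 => [|k ki]; rewrite !mxE.
  by rewrite !eqxx mulr1.
by rewrite (negPf ki) mulr0.
Qed.

Lemma dot_ge0 x : 0 <= dot x x.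
Proof. by apply: sumr_ge0 => k _; rewrite -expr2 sqr_ge0. Qed.

Lemma enorm_sqr x : enorm x ^+ 2 = dot x x.
Proof. by rewrite sqr_sqrtr ?dot_ge0. Qed.

Lemma dot_cauchy x y : dot x y ^+ 2 <= dot x x * dot y y.
Proof.
rewrite -subr_ge0 !dotE.
set a := x 0 0; set b := x 1 0; set c := x 2 0.
set d := y 0 0; set e := y 1 0; set f := y 2 0.
rewrite (_ : _ - _ = (a * e - b * d) ^+ 2 + (a * f - c * d) ^+ 2
   + (b * f - c * e) ^+ 2); last by ring.
by rewrite !addr_ge0 ?sqr_ge0.
Qed.

(** The product of the components orthogonal to the i-th axis. *)
Lemma perp_dot x y i :
  dot (x - x i 0 *: delta_mx i 0) (y - y i 0 *: delta_mx i 0)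
  = dot x y - x i 0 * y i 0.
Proof.
rewrite !dot_lin !dot_delta (dotC (delta_mx i 0)) dot_delta !mxE !eqxx /=.
ring.
Qed.

Lemma dot_cauchy_perp x y i :
  (dot x y - x i 0 * y i 0) ^+ 2
  <= (dot x x - x i 0 ^+ 2) * (dot y y - y i 0 ^+ 2).
Proof. by rewrite !expr2 -!perp_dot -expr2 dot_cauchy. Qed.

Lemma coord_sqr_le x i : x i 0 ^+ 2 <= dot x x.
Proof. by rewrite -subr_ge0 expr2 -perp_dot dot_ge0. Qed.

(** Cauchy-Schwarz in R^4.  In wave_bound the extra coordinate carries the
    internal energy. *)
Lemma dot_cauchy_ext (s t : R) x y :
  (s * t + dot x y) ^+ 2 <= (s ^+ 2 + dot x x) * (t ^+ 2 + dot y y).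
Proof.
have := dot_ge0 (s *: y - t *: x); rewrite !dot_lin (dotC y x).
have := dot_cauchy x y; nra.
Qed.

End Dot.

Lemma ler_sqr_norm (R : realDomainType) (x y : R) :
  0 <= y -> x ^+ 2 <= y ^+ 2 -> `|x| <= y.
Proof.
move=> y0 xy; rewrite -(@ler_pXn2r _ 2) ?nnegrE ?normr_ge0 //.
by rewrite real_normK ?num_real.
Qed.

(** * The probe functional *)

Section State.
Variable R : realType.
Implicit Types (U : state R) (v B w b : 'cV[R]_3) (p : R -> R -> R) (i : 'I_3).

Lemma rho_mk r m B (E : R) : rho (mk_state r m B E) = r.
Proof. by rewrite /rho /mk_state col_mxKu mxE eqxx. Qed.
Lemma mom_mk r m B (E : R) : mom (mk_state r m B E) = m.
Proof. by rewrite /mom /mk_state col_mxKd col_mxKu. Qed.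
Lemma mag_mk r m B (E : R) : mag (mk_state r m B E) = B.
Proof. by rewrite /mag /mk_state !col_mxKd col_mxKu. Qed.
Lemma energy_mk r m B (E : R) : energy (mk_state r m B E) = E.
Proof. by rewrite /energy /mk_state !col_mxKd mxE eqxx. Qed.

Lemma rho_linear a U V : rho (a *: U + V) = a * rho U + rho V.
Proof. by rewrite /rho !mxE. Qed.

(** The part linear in U of rho |v_U - v|^2/2 + internal_energy U +
    |B_U - B|^2/2, the constant |B|^2/2 being left out. *)
Definition probe v B U : R :=
  energy U + rho U * (dot v v / 2) - dot v (mom U) - dot B (mag U).

Lemma probe_linear v B a U V :
  probe v B (a *: U + V) = a * probe v B U + probe v B V.
Proof.
rewrite /probe /energy /rho /mom /mag !linearP !mxE /= !dot_lin.
rewrite /GRing.scale /=; ring.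
Qed.

Lemma energyE U : rho U != 0 -> energy U = internal_energy U
  + rho U * dot (vel U) (vel U) / 2 + dot (mag U) (mag U) / 2.
Proof.
by move=> r0; rewrite /internal_energy !enorm_sqr /vel !dot_lin; field.
Qed.

(** The case of probeE in which both squares vanish. *)
Lemma probe_self U : rho U != 0 ->
  internal_energy U = probe (vel U) (mag U) U + dot (mag U) (mag U) / 2.
Proof.
by move=> r0; rewrite /internal_energy /probe !enorm_sqr /vel !dot_lin; field.
Qed.

Lemma probeE v B U : rho U != 0 ->
  probe v B U + dot B B / 2 = rho U * dot (vel U - v) (vel U - v) / 2
    + internal_energy U + dot (mag U - B) (mag U - B) / 2.
Proof.
move=> r0; rewrite /internal_energy /probe !enorm_sqr /vel !dot_lin.
by rewrite (dotC (mom U) v) (dotC (mag U) B); field.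
Qed.

(** The isolated terms B_U_i (v . B) and v_i |B|^2/2 are what remains when the
    flux is written in the relative quantities w and b.  They are unbounded in
    v and B, and are put on the left because they cancel later: the second
    between the two states of a pair, the first over all pairs.  The magnetic
    energy is transported with v_i and not with the velocity of U: the
    coefficient v_U_i |b|^2/2 loses w_i |b|^2/2 to the magnetic pressure,
    through |B_U|^2/2 = B_U . b + (|B|^2 - |b|^2)/2. *)
Lemma probe_flux p i v B U : rho U != 0 ->
  let w := vel U - v in let b := mag U - B in
  probe v B (flux p i U) - mag U i 0 * dot v B + v i 0 * (dot B B / 2)
  = vel U i 0 * (rho U * dot w w / 2 + internal_energy U) + v i 0 * (dot b b / 2)
    + (pressure p U * w i 0 + w i 0 * dot (mag U) b - mag U i 0 * dot w b).
Proof.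
move=> r0 w b; rewrite /probe /flux energy_mk rho_mk mom_mk mag_mk /ptot.
rewrite energyE // enorm_sqr /w /b; move: (vel U) (mag U) => u H.
have -> : (u - v) i 0 = u i 0 - v i 0 by rewrite !mxE.
rewrite !dot_lin !dot_delta (dotC u v) (dotC H B) (dotC B u).
by field.
Qed.

End State.

(** * The fast magnetosonic speed as a norm *)

Section Wave.
Variable R : realType.
Implicit Types (U : state R) (v B w b : 'cV[R]_3) (p : R -> R -> R) (i : 'I_3).

(** A point where the quadratic is nonpositive lies between the two roots. *)
Lemma larger_root (a d x : R) : 4 * d <= a ^+ 2 ->
  let l := (a + Num.sqrt (a ^+ 2 - 4 * d)) / 2 in
  l ^+ 2 - a * l + d = 0 /\ (x ^+ 2 - a * x + d <= 0 -> x <= l).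
Proof.
move=> da l; have D0 : 0 <= a ^+ 2 - 4 * d by rewrite subr_ge0.
have := sqr_sqrtr D0; have := sqrtr_ge0 (a ^+ 2 - 4 * d).
rewrite /l; move: (Num.sqrt _) => s s0 s2; split=> [|xl].
  have -> : d = (a ^+ 2 - s ^+ 2) / 4 by rewrite s2; field.
  by field.
have /(ler_sqr_norm s0) : (2 * x - a) ^+ 2 <= s ^+ 2 by rewrite s2; nra.
by rewrite ler_norml => /andP[_]; lra.
Qed.

(** The square of Cdir is the larger root of the characteristic polynomial
    x^2 - (Cs^2 + |B|^2/rho) x + Cs^2 B_i^2/rho.  The three conclusions are the
    ones that make the symmetric 2 x 2 matrix with diagonal mu - c, mu - h and
    off-diagonal entry of square h (n - h) positive semidefinite; the two
    inequalities hold because the polynomial is nonpositive at h / rho and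
    c / rho. *)
Lemma Cdir_root p i U : 0 < rho U ->
  let n := dot (mag U) (mag U) in let h := mag U i 0 ^+ 2 in
  let mu := rho U * Cdir p i U ^+ 2 in
  let c := rho U * Cs p U ^+ 2 + (n - h) in
  [/\ (mu - h) * (mu - c) = h * (n - h), h <= mu & c <= mu].
Proof.
move=> r0 n h mu c.
have n_h : 0 <= n - h by rewrite subr_ge0 coord_sqr_le.
have h0 : 0 <= h by rewrite sqr_ge0.
pose q := Cs p U ^+ 2; have q0 : 0 <= q by rewrite sqr_ge0.
pose a := q + n / rho U; pose d := q * h / rho U.
have rN : rho U != 0 by rewrite gt_eqF.
have da : 4 * d <= a ^+ 2.
  have nh : h / rho U <= n / rho U by rewrite ler_pM2r ?invr_gt0 // -subr_ge0.
  have h0' : 0 <= h / rho U by rewrite divr_ge0 // ltW.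
  (* With x = h / rho and y = n / rho: 4 q x <= (q + x)^2 <= (q + y)^2. *)
  rewrite /d /a -mulrA; move: nh h0'; move: (h / _) (n / _) => x y xy x0.
  have : (q + x) ^+ 2 <= (q + y) ^+ 2.
    by rewrite ler_pXn2r ?nnegrE ?addr_ge0 ?lerD2l // (le_trans x0).
  by have := sqr_ge0 (q - x); nra.
have C2 : Cdir p i U ^+ 2 = (a + Num.sqrt (a ^+ 2 - 4 * d)) / 2.
  rewrite /Cdir enorm_sqr -/n -/q -/a -/h -/d exprMn exprVn sqr_sqrtr ?ler0n //.
  have a0 : 0 <= a by rewrite addr_ge0 // divr_ge0 ?dot_ge0 // ltW.
  by rewrite sqr_sqrtr ?(addr_ge0 a0) ?sqrtr_ge0 // mulrC.
have muE : mu / rho U = (a + Num.sqrt (a ^+ 2 - 4 * d)) / 2.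
  by rewrite -C2 /mu mulrC mulKf.
have below x : x ^+ 2 - (rho U * q + n) * x + rho U * q * h <= 0 -> x <= mu.
  move=> xle; rewrite -(ler_pM2r (_ : 0 < (rho U)^-1)) ?invr_gt0 // muE.
  apply: (larger_root (x / rho U) da).2.
  have -> : (x / rho U) ^+ 2 - a * (x / rho U) + d
    = (x ^+ 2 - (rho U * q + n) * x + rho U * q * h) / rho U ^+ 2.
    by rewrite /a /d; field.
  by rewrite pmulr_lle0 // invr_gt0 exprn_gt0.
split; first last.
- by apply: below; rewrite /c -/q; nra.
- by apply: below; rewrite /c -/q; nra.
have [+ _] := larger_root 0 da; rewrite /= -muE => root.
apply/eqP; rewrite -subr_eq0; apply/eqP.
rewrite -(mulr0 (rho U ^+ 2)) -root /a /d /c -/q; by field.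
Qed.

(** Cdir bounds the operator w |-> (Cs w_i, w_i B - B_i w).  Splitting w and B
    into the i-th component and the orthogonal rest turns the difference of
    the two sides into a binary quadratic form in w_i and |w_perp|, bounded
    below by the one whose matrix is that of Cdir_root. *)
Lemma wave_form_le p i U w : 0 < rho U ->
  rho U * (Cs p U * w i 0) ^+ 2
  + dot (w i 0 *: mag U - mag U i 0 *: w) (w i 0 *: mag U - mag U i 0 *: w)
  <= rho U * Cdir p i U ^+ 2 * dot w w.
Proof.
set z := _ - _ => r0; have [] := Cdir_root p i r0.
have := dot_cauchy_perp w (mag U) i; have := coord_sqr_le w i.
have -> : dot z z = w i 0 ^+ 2 * dot (mag U) (mag U)
   - 2 * (w i 0 * mag U i 0) * dot w (mag U) + mag U i 0 ^+ 2 * dot w w.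
  by rewrite /z !dot_lin (dotC (mag U) w); ring.
rewrite (exprMn _ (Cs p U)) (mulrA (rho U) (Cs p U ^+ 2)).
move: (rho U * Cdir p i U ^+ 2) (rho U * Cs p U ^+ 2) => mu s.
move: (dot w w) (dot (mag U) (mag U)) (dot w (mag U)).
move: (w i 0) (mag U i 0) => x h q n t xq tq; set A := mu - (_ + _).
move=> AC hmu Amu.
have A0 : 0 <= A by rewrite subr_ge0.
have C0 : 0 <= mu - h ^+ 2 by rewrite subr_ge0.
have q0 : 0 <= q - x ^+ 2 by rewrite subr_ge0.
have F0 : 0 <= A * x ^+ 2 + (mu - h ^+ 2) * (q - x ^+ 2).
  by rewrite addr_ge0 // mulr_ge0 ?sqr_ge0.
(* The cross term is dominated by the diagonal ones as 4XY <= (X + Y)^2. *)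
have /(ler_sqr_norm F0) : (2 * x * h * (t - x * h)) ^+ 2
    <= (A * x ^+ 2 + (mu - h ^+ 2) * (q - x ^+ 2)) ^+ 2.
  have : 4 * x ^+ 2 * h ^+ 2 * (t - x * h) ^+ 2
      <= 4 * x ^+ 2 * h ^+ 2 * ((q - x ^+ 2) * (n - h ^+ 2)).
    apply: ler_wpM2l tq; apply: mulr_ge0 (sqr_ge0 _).
    by apply: mulr_ge0 (sqr_ge0 _).
  have -> : 4 * x ^+ 2 * h ^+ 2 * ((q - x ^+ 2) * (n - h ^+ 2))
     = 4 * (A * x ^+ 2) * ((mu - h ^+ 2) * (q - x ^+ 2)).
    transitivity (4 * x ^+ 2 * (q - x ^+ 2) * ((mu - h ^+ 2) * A)); last by ring.
    by rewrite AC; ring.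
  have := sqr_ge0 (A * x ^+ 2 - (mu - h ^+ 2) * (q - x ^+ 2)).
  move: (A * x ^+ 2) ((mu - h ^+ 2) * (q - x ^+ 2)) (t - x * h) => X Y T.
  rewrite !exprMn; lra.
rewrite ler_norml => /andP[+ _]; rewrite /A; lra.
Qed.

(** With y = sqrt (2 e), where e is the specific internal energy, the pressure
    is Cs rho y.  The form is thus the product in R^4 of
    (sqrt rho y, b) and (sqrt rho Cs w_i, w_i B - B_i w), so that
    Cauchy-Schwarz and wave_form_le apply. *)
Lemma wave_bound p i U w b : admissible U ->
  `|pressure p U * w i 0 + w i 0 * dot (mag U) b - mag U i 0 * dot w b|
  <= Cdir p i U * (rho U * dot w w / 2 + internal_energy U + dot b b / 2).
Proof.
move=> [r0 e0]; have rN : rho U != 0 by rewrite gt_eqF.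
pose y := Num.sqrt (2 * spec_energy U).
pose z := w i 0 *: mag U - mag U i 0 *: w.
have y2 : rho U * y ^+ 2 = 2 * internal_energy U.
  rewrite sqr_sqrtr /spec_energy; first by field.
  by rewrite mulr_ge0 // divr_ge0 // ltW.
have yN : y != 0.
  by apply/eqP => y_0; move: y2 e0; rewrite y_0 expr0n mulr0; lra.
have pE : pressure p U = Cs p U * rho U * y.
  by rewrite /Cs -/y; field; rewrite yN.
pose r := Num.sqrt (rho U).
have r2 : r ^+ 2 = rho U by rewrite sqr_sqrtr // ltW.
have -> : pressure p U * w i 0 + w i 0 * dot (mag U) b - mag U i 0 * dot w b
    = r * y * (r * (Cs p U * w i 0)) + dot b z.
  by rewrite pE -r2 /z !dot_lin !(dotC b); ring.
have F0 : 0 <= rho U * dot w w / 2 + internal_energy U + dot b b / 2.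
  apply: addr_ge0; last by rewrite divr_ge0 ?dot_ge0.
  by rewrite addr_ge0 ?(ltW e0) // divr_ge0 // mulr_ge0 ?dot_ge0 // ltW.
apply: ler_sqr_norm; first by rewrite mulr_ge0 ?Cdir_ge0.
apply: le_trans (dot_cauchy_ext _ _ _ _) _.
rewrite (exprMn _ r y) r2 y2 (exprMn _ r) r2 (exprMn _ (Cdir p i U)).
have := wave_form_le p i w r0; rewrite -/z => H.
apply: le_trans; first apply: ler_wpM2l H.
  by rewrite addr_ge0 ?dot_ge0 // mulr_ge0 // ltW.
have -> : (2 * internal_energy U + dot b b)
    * (rho U * Cdir p i U ^+ 2 * dot w w)
  = Cdir p i U ^+ 2 * ((2 * internal_energy U + dot b b) * (rho U * dot w w)).
  by ring.
rewrite ler_wpM2l ?sqr_ge0 //; move: (rho U * _) (internal_energy U) (dot b b).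
by move=> X Y Z; have := sqr_ge0 (X - (2 * Y + Z)); nra.
Qed.

End Wave.

(** * One pair of states *)

Section Splitting.
Variable R : realType.
Implicit Types (U : state R) (v B w b : 'cV[R]_3) (p : R -> R -> R) (i : 'I_3).

Lemma weighted_cauchy (r r' s t x y : R) : 0 < r -> 0 < r' ->
  (s * x + t * y) ^+ 2
  <= (s ^+ 2 / r + t ^+ 2 / r') * (r * x ^+ 2 + r' * y ^+ 2).
Proof.
move=> r0 r0'; rewrite -subr_ge0.
have -> : (s ^+ 2 / r + t ^+ 2 / r') * (r * x ^+ 2 + r' * y ^+ 2)
    - (s * x + t * y) ^+ 2 = (s * y * r' - t * x * r) ^+ 2 / (r * r').
  by field; rewrite !gt_eqF.
by rewrite divr_ge0 ?sqr_ge0 // ltW // mulr_gt0.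
Qed.

(** |b|^2 - |b'|^2 factors as (b - b') . (b + b'), and b - b' is the jump of the
    magnetic field whatever the reference field is.  This is why the bound
    involves only the jump and energies, and not the reference field. *)
Lemma coupling_bound i (r r' s : R) (w w' b b' : 'cV[R]_3) : 0 < r -> 0 < r' ->
  `|(s * w i 0 + (1 - s) * w' i 0) * (dot b b / 2 - dot b' b' / 2)|
  <= enorm (b' - b) / Num.sqrt 2 * Num.sqrt (s ^+ 2 / r + (1 - s) ^+ 2 / r')
     * (r * dot w w / 2 + r' * dot w' w' / 2 + (dot b b / 2 + dot b' b' / 2)).
Proof.
move=> r0 r0'; set K := s ^+ 2 / r + _; set m := s * _ + _.
rewrite -(mulrDl (r * _)) -(mulrDl (dot b b)) -mulrBl; pose d := b' - b.
have K0 : 0 <= K by rewrite /K addr_ge0 ?divr_ge0 ?sqr_ge0 ?ltW.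
have dd0 := dot_ge0 d.
have M0 : 0 <= r * dot w w + r' * dot w' w'.
  by apply: addr_ge0; apply: mulr_ge0; rewrite ?dot_ge0 // ltW.
have N0 : 0 <= dot b b + dot b' b' by rewrite addr_ge0 ?dot_ge0.
apply: ler_sqr_norm.
  by rewrite !mulr_ge0 ?addr_ge0 ?divr_ge0 ?invr_ge0 ?sqrtr_ge0.
rewrite [leRHS]exprMn (exprMn _ (_ / Num.sqrt 2)) (exprMn _ (enorm _)).
rewrite enorm_sqr exprVn !sqr_sqrtr ?ler0n // -/d.
have mK : m ^+ 2 <= K * (r * dot w w + r' * dot w' w').
  apply: le_trans (weighted_cauchy _ _ _ _ r0 r0') _; rewrite -/K ler_wpM2l //.
  by rewrite lerD // ler_wpM2l ?coord_sqr_le // ltW.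
have diffE : dot b b - dot b' b' = - dot d (b + b').
  by rewrite /d !dot_lin (dotC b' b); ring.
(* The factor 2 here is what leaves 1 / sqrt 2 in the bound. *)
have sumN : dot (b + b') (b + b') <= 2 * (dot b b + dot b' b').
  by have := dot_ge0 (b - b'); rewrite !dot_lin (dotC b' b); lra.
have dN : dot d (b + b') ^+ 2 <= dot d d * (2 * (dot b b + dot b' b')).
  by apply: le_trans (dot_cauchy _ _) _; rewrite ler_wpM2l.
rewrite diffE; move: mK dN; clear diffE sumN; clearbody m K.
move: (r * _ + _) M0 (dot b b + _) N0 (dot d _) (dot d d) dd0.
move=> M M0 N N0 e D D0 mK eN.
have -> : (m * (- e / 2)) ^+ 2 = m ^+ 2 * e ^+ 2 / 4 by field.
have : m ^+ 2 * e ^+ 2 <= (K * M) * (D * (2 * N)).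
  by rewrite ler_pM ?sqr_ge0.
have : 0 <= K * D * (M - N) ^+ 2 by rewrite mulr_ge0 ?sqr_ge0 ?mulr_ge0.
by lra.
Qed.

(** The form in which alpha_sigma is used: each speed that multiplies an energy
    of the pair is separately at most alpha_sigma. *)
Lemma alpha_sigma_bounds p i U U' s :
  let D := enorm (mag U' - mag U) / Num.sqrt 2
    * Num.sqrt (s ^+ 2 / rho U + (1 - s) ^+ 2 / rho U') in
  let vs := s * vel U i 0 + (1 - s) * vel U' i 0 in
  let a := alpha_sigma p i U U' s in
  [/\ 0 <= D, `|vel U i 0| + Cdir p i U + D <= a,
      `|vel U' i 0| + Cdir p i U' + D <= a,
      `|vs| + Cdir p i U + D <= a & `|vs| + Cdir p i U' + D <= a].
Proof.
move=> D vs a; rewrite /a /alpha_sigma -/D -/vs.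
split; first by rewrite /D !mulr_ge0 ?invr_ge0 ?sqrtr_ge0.
all: by rewrite lerD2r !le_max ?lerD2l ?le_max ?lexx ?orbT.
Qed.

Lemma alpha_sigma_ge_speed p i U U' s :
  `|vel U i 0| <= alpha_sigma p i U U' s
  /\ `|vel U' i 0| <= alpha_sigma p i U U' s.
Proof.
have [] := alpha_sigma_bounds p i U U' s.
have := Cdir_ge0 p i U; have := Cdir_ge0 p i U'; lra.
Qed.

Lemma alpha_sigma_ge0 p i U U' s : 0 <= alpha_sigma p i U U' s.
Proof.
by have [/(le_trans (normr_ge0 _))] := alpha_sigma_ge_speed p i U U' s.
Qed.

(** The bookkeeping of the pair estimate.  T and T' are the kinetic plus
    internal energies, H and H' the magnetic ones, all relative to the
    references.  Since vi H - vi H' = vs (H - H') - (vs - vi) (H - H'), each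
    energy is multiplied by a total speed that one of the hypotheses bounds by
    al; strictness comes from al < a and the positive total energy. *)
Lemma speed_budget (a al D C C' u u' vs vi T T' H H' X X' : R) :
  al < a -> `|u| + C + D <= al -> `|u'| + C' + D <= al ->
  `|vs| + C + D <= al -> `|vs| + C' + D <= al ->
  0 < T -> 0 < T' -> 0 <= H -> 0 <= H' ->
  `|(vs - vi) * (H - H')| <= D * ((T + T') + (H + H')) ->
  `|X| <= C * (T + H) -> `|X'| <= C' * (T' + H') ->
  (u * T + vi * H + X) - (u' * T' + vi * H' + X') < a * (T + H + (T' + H')).
Proof.
move=> ala cu cu' cvs cvs' T0 T0' H0 H0'; rewrite !ler_norml.
move=> /andP[gap _] /andP[_ hX] /andP[hX' _].
have mono (c x y : R) : c <= al -> 0 <= x -> y <= c * x -> y <= al * x.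
  by move=> cal x0 /le_trans; apply; rewrite ler_wpM2r.
have normM (x y : R) : 0 <= y -> x * y <= `|x| * y.
  by move=> y0; rewrite ler_wpM2r ?ler_norm.
have h1 := mono _ _ _ cu (ltW T0) (lexx _).
have h2 := mono _ _ _ cu' (ltW T0') (lexx _).
have h3 := mono _ _ _ cvs H0 (lexx _).
have h4 := mono _ _ _ cvs' H0' (lexx _).
have n1 := normM u T (ltW T0); have := normM (- u') T' (ltW T0').
rewrite normrN => n2.
have n3 := normM vs H H0; have := normM (- vs) H' H0'; rewrite normrN => n4.
apply: (@le_lt_trans _ _ (al * (T + H + (T' + H')))); first by lra.
by rewrite ltr_pM2r //; lra.
Qed.

(** The pair estimate.  It holds for all reference vectors v and B at once,
    which matters because they are later chosen depending on the average. *)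
Lemma probe_splitting p i v B U U' s a : admissible U -> admissible U' ->
  alpha_sigma p i U U' s < a ->
  0 < probe v B U + probe v B U' + dot B B
      - a^-1 * (probe v B (flux p i U) - probe v B (flux p i U')
                - (mag U i 0 - mag U' i 0) * dot v B).
Proof.
move=> gU gU' lta; have [r0 e0] := gU; have [r0' e0'] := gU'.
have rN : rho U != 0 by rewrite gt_eqF.
have rN' : rho U' != 0 by rewrite gt_eqF.
have a0 := le_lt_trans (alpha_sigma_ge0 p i U U' s) lta.
rewrite -(pmulr_rgt0 _ a0) mulrBr mulrA divff ?gt_eqF // mul1r subr_gt0.
(* Each state of the pair takes half of |B|^2 and its own v_i |B|^2/2. *)
have -> : probe v B U + probe v B U' + dot B B
  = probe v B U + dot B B / 2 + (probe v B U' + dot B B / 2) by field.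
rewrite (probeE v B rN) (probeE v B rN').
have regroup (x y h h' g z : R) :
  x - y - (h - h') * g = (x - h * g + z) - (y - h' * g + z) by ring.
rewrite (regroup _ _ _ _ _ (v i 0 * (dot B B / 2))).
rewrite (probe_flux p i v B rN) (probe_flux p i v B rN').
have K0 := mulr_ge0 (ltW r0) (dot_ge0 (vel U - v)).
have K0' := mulr_ge0 (ltW r0') (dot_ge0 (vel U' - v)).
have [D0 b1 b2 b3 b4] := alpha_sigma_bounds p i U U' s.
apply: (speed_budget lta b1 b2 b3 b4); last 2 first.
- exact: wave_bound.
- exact: wave_bound.
- by rewrite ltr_wpDl // divr_ge0.
- by rewrite ltr_wpDl // divr_ge0.
- by rewrite divr_ge0 ?dot_ge0.
- by rewrite divr_ge0 ?dot_ge0.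
have := coupling_bound i s (vel U - v) (vel U' - v) (mag U - B) (mag U' - B)
  r0 r0'.
have -> : mag U' - B - (mag U - B) = mag U' - mag U.
  by rewrite opprB addrA subrK.
have -> : s * (vel U - v) i 0 + (1 - s) * (vel U' - v) i 0
  = s * vel U i 0 + (1 - s) * vel U' i 0 - v i 0 by rewrite !mxE; ring.
move/le_trans; apply; apply: ler_wpM2l => //.
by rewrite lerD2r lerD // lerDl ltW.
Qed.

End Splitting.

(** * Averaging over all pairs *)

Section Averaging.
Variable R : realType.

(** The density flux is rho times the velocity, and alpha_sigma dominates the
    velocity, so that each of rho (1 - v_i / a) and rho' (1 + v'_i / a) is
    positive. *)
Lemma rho_splitting (p : R -> R -> R) i (U U' : state R) s a :
  admissible U -> admissible U' -> alpha_sigma p i U U' s < a ->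
  0 < rho U + rho U' - a^-1 * (rho (flux p i U) - rho (flux p i U')).
Proof.
move=> [r0 _] [r0' _] lta; rewrite /flux !rho_mk.
have [le1 le2] := alpha_sigma_ge_speed p i U U' s.
have a0 := le_lt_trans (alpha_sigma_ge0 p i U U' s) lta.
have v1 := le_lt_trans (ler_norm _) (le_lt_trans le1 lta).
have := le_lt_trans le2 lta; rewrite ltr_norml => /andP[v2 _].
rewrite -(pmulr_rgt0 _ a0) mulrBr mulrA divff ?gt_eqF // mul1r.
move: (vel U i 0) (vel U' i 0) v1 v2 => u u' v1 v2.
have -> : a * (rho U + rho U') - (rho U * u - rho U' * u')
  = (a - u) * rho U + (a + u') * rho U' by ring.
by rewrite addr_gt0 // mulr_gt0 //; lra.
Qed.

Lemma lt_alpha_sigma (p : R -> R -> R) i Q (Q_gt0 : (0 < Q)%N)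
    (U U' : 'I_Q -> state R) a :
  (forall k, admissible (U k)) -> (forall k, admissible (U' k)) ->
  max_over Q_gt0 (fun k => alpha p i (U k) (U' k)) < a ->
  forall k, exists s, alpha_sigma p i (U k) (U' k) s < a.
Proof.
move=> gU gU' lta k; have [s sE _] := alpha_is_min p i (gU k) (gU' k).
exists s; rewrite -sE; apply: le_lt_trans lta; rewrite /max_over.
exact: (le_bigmax _ (fun k => alpha p i (U k) (U' k))).
Qed.

(** The pair estimates carry a term of no definite sign, d1 k * g or d2 k * g.
    The weights of the average multiply it by a1 / dx * a1^-1 = 1 / dx and by
    1 / dy, so these terms add up to g times the discrete divergence.  L stands
    for the density or for a probe functional; N is |B|^2 in the latter case. *)
Lemma average_gt0 (V : lmodType R) (L : V -> R) Q
    (dx dy a1 a2 N g : R) (w d1 d2 : 'I_Q -> R)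
    (x x' y y' fx fx' fy fy' : 'I_Q -> V) :
  (forall a u v, L (a *: u + v) = a * L u + L v) ->
  (0 < Q)%N -> 0 < dx -> 0 < dy -> 0 < a1 -> 0 < a2 ->
  (forall k, 0 < w k) -> \sum_(k < Q) w k = 1 ->
  (\sum_(k < Q) w k * d1 k) / dx + (\sum_(k < Q) w k * d2 k) / dy = 0 ->
  (forall k, 0 < L (x k) + L (x' k) + N
                 - a1^-1 * (L (fx k) - L (fx' k) - d1 k * g)) ->
  (forall k, 0 < L (y k) + L (y' k) + N
                 - a2^-1 * (L (fy k) - L (fy' k) - d2 k * g)) ->
  0 < L ((2 * (a1 / dx + a2 / dy))^-1 *: \sum_(k < Q) w k *:
         ((a1 / dx) *: (x k - a1^-1 *: fx k + x' k + a1^-1 *: fx' k)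
          + (a2 / dy) *: (y k - a2^-1 *: fy k + y' k + a2^-1 *: fy' k)))
      + N / 2.
Proof.
move=> Llin Q0 dx0 dy0 a10 a20 w0 w1 div0 Lx Ly.
have L0 : L 0 = 0 by have := Llin 1 0 0; rewrite scaler0 addr0 mul1r; lra.
have LZ a u : L (a *: u) = a * L u by rewrite -[_ *: _]addr0 Llin L0 addr0.
have LD u v : L (u + v) = L u + L v by rewrite -[u]scale1r Llin mul1r scale1r.
have LN u : L (- u) = - L u by rewrite -scaleN1r LZ mulN1r.
have Lsum (f : 'I_Q -> V) : L (\sum_(k < Q) f k) = \sum_(k < Q) L (f k).
  exact: (big_morph L LD L0).
set c := a1 / dx + a2 / dy; have c0 : 0 < c by rewrite addr_gt0 ?divr_gt0.
have c20 : 0 < 2 * c by rewrite mulr_gt0.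
rewrite LZ Lsum -(pmulr_rgt0 _ c20) mulrDr mulVKf ?gt_eqF //.
pose Z k := a1 / dx * (L (x k) + L (x' k) + N
               - a1^-1 * (L (fx k) - L (fx' k) - d1 k * g))
          + a2 / dy * (L (y k) + L (y' k) + N
               - a2^-1 * (L (fy k) - L (fy' k) - d2 k * g)).
have Z0 : 0 < \sum_(k < Q) w k * Z k.
  suff : \sum_(k < Q) (0 : R) < \sum_(k < Q) w k * Z k by rewrite big1.
  apply: ltr_sum => [|k _]; last first.
    by rewrite mulr_gt0 // addr_gt0 // mulr_gt0 ?divr_gt0.
  by apply/hasP; exists (Ordinal Q0); rewrite ?mem_index_enum.
apply: lt_le_trans Z0 _; rewrite le_eqVlt; apply/orP; left; apply/eqP.
have -> : 2 * c * (N / 2) = \sum_(k < Q) w k * (c * N)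
     + g * ((\sum_(k < Q) w k * d1 k) / dx + (\sum_(k < Q) w k * d2 k) / dy).
  by rewrite div0 mulr0 addr0 -mulr_suml w1; field.
rewrite !mulr_suml mulrDr !mulr_sumr -!big_split /=; apply: eq_bigr => k _.
rewrite !(LZ, LD, LN) /Z /c.
by field; rewrite !gt_eqF.
Qed.

End Averaging.

Theorem theorem2p15 (R : realType) (p : R -> R -> R) (hp : is_eos p)
    (Q : nat) (Q_gt0 : (0 < Q)%N) (dx dy : R) (dx_gt0 : 0 < dx) (dy_gt0 : 0 < dy)
    (w : 'I_Q -> R) (w_gt0 : forall k, 0 < w k) (w_sum : \sum_(k < Q) w k = 1)
    (Ubar Utilde Uhat Ucheck : 'I_Q -> state R)
    (GUbar : forall k, admissible (Ubar k))
    (GUtilde : forall k, admissible (Utilde k))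
    (GUhat : forall k, admissible (Uhat k))
    (GUcheck : forall k, admissible (Ucheck k))
    (hdiv :
      (\sum_(k < Q) w k * (mag (Ubar k) dir1 0 - mag (Utilde k) dir1 0)) / dx
      + (\sum_(k < Q) w k * (mag (Uhat k) dir2 0 - mag (Ucheck k) dir2 0)) / dy
      = 0)
    (a1 a2 : R)
    (ha1 : max_over Q_gt0 (fun k => alpha p dir1 (Ubar k) (Utilde k)) < a1)
    (ha2 : max_over Q_gt0 (fun k => alpha p dir2 (Uhat k) (Ucheck k)) < a2) :
  admissible
    ((2 * (a1 / dx + a2 / dy))^-1 *:
     \sum_(k < Q) w k *:
       ((a1 / dx) *: (Ubar k - a1^-1 *: flux p dir1 (Ubar k)
                      + Utilde k + a1^-1 *: flux p dir1 (Utilde k))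
        + (a2 / dy) *: (Uhat k - a2^-1 *: flux p dir2 (Uhat k)
                        + Ucheck k + a2^-1 *: flux p dir2 (Ucheck k)))).
Proof.
have s1 := lt_alpha_sigma GUbar GUtilde ha1.
have s2 := lt_alpha_sigma GUhat GUcheck ha2.
have a1_gt0 : 0 < a1.
  have [s] := s1 (Ordinal Q_gt0).
  exact: le_lt_trans (alpha_sigma_ge0 _ _ _ _ _).
have a2_gt0 : 0 < a2.
  have [s] := s2 (Ordinal Q_gt0).
  exact: le_lt_trans (alpha_sigma_ge0 _ _ _ _ _).
set W := _ *: _.
have rW : 0 < rho W.
  suff : 0 < rho W + 0 / 2 by rewrite mul0r addr0.
  apply: (@average_gt0 _ _ (@rho R) _ _ _ _ _ _ 0) (@rho_linear R)
    _ _ _ _ _ _ _ hdiv _ _ => // k.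
    rewrite mulr0 subr0 addr0; have [s lts] := s1 k.
    exact: rho_splitting (GUbar k) (GUtilde k) lts.
  rewrite mulr0 subr0 addr0; have [s lts] := s2 k.
  exact: rho_splitting (GUhat k) (GUcheck k) lts.
split=> //; rewrite probe_self ?gt_eqF //.
apply: (average_gt0 (L := probe (vel W) (mag W)) (g := dot (vel W) (mag W)))
  (@probe_linear R _ _) _ _ _ _ _ _ _ hdiv _ _ => // k.
  by have [s lts] := s1 k; apply: probe_splitting (GUbar k) (GUtilde k) lts.
by have [s lts] := s2 k; apply: probe_splitting (GUhat k) (GUcheck k) lts.
Qed.
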